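(* Let $D$, $n$, $\Lambda$, constants $c_\alpha\in\mathbb R$ ($\alpha\in\Pi^\circ$), and a weighted context-free grammar $\Gamma=(D,N,S,R,\nu)$ in Chomsky Normal Form (in the sense given in the context), such that for every rule $A\to w$ in $R$ the word $w$ belongs to $\Lambda$, be as in the context. Consider the following procedure, which computes numbers (''messages'') $M_A(\alpha,\beta)$ for $A\in N$ and $\alpha,\beta\in\Pi$ with $\beta\succ\alpha$. 1. Set $M_A(\alpha,\beta):=+\infty$ for all messages. 2. For each rule $A\to w$ in $R$ and each $\alpha\in\Pi$ set $M_A(\alpha,\mathrm{lsp}(\alpha w)):=f(\alpha w)+\nu(A\to w)$. 3. For each $\alpha,\beta\in\Pi$ with $\beta\succ\alpha$, in the order of increasing $j_\beta-j_\alpha$, set (for $A\in N$) $$M_A(\alpha,\beta):=\min_{r=(A\to BC)\in R}\ \min_{\gamma\in\Pi:\ \beta\succ\gamma\succ\alpha}\bigl(M_B(\alpha,\gamma)+M_C(\gamma,\beta)-f(\gamma)+\nu(r)\bigr).$$ 4. Return $\min_{\alpha\in\Pi_n}M_S(\varepsilon_0,\alpha)$. Then the procedure is correct, i.e. it returns the correct value of $M=\min_{x\in D^{1:n}}F(x)$, where $F(x)=f(x)+C_\Gamma(x)$.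
   Context: $D$ is a finite alphabet, $D^*=\bigcup_{k\ge0}D^k$ the set of words over $D$, $\varepsilon$ the empty word, $n\ge 1$ an integer, and $\Lambda\subseteq D^*$ a finite set of words. Patterns. A pattern is a pair $\alpha=([i,j],w)$ with $[i,j]$ an integer interval in $[1,n]$ (possibly empty, $j=i-1$, with $0\le j\le n$) and $w=w_i\dots w_j$ a word over $D$ indexed by $[i,j]$; write $i_\alpha=i$, $j_\alpha=j$, $w_\alpha=w$, $|\alpha|=j-i+1$. $\varepsilon_s=([s+1,s],\varepsilon)$ is the empty pattern at position $s$. $D^{i:j}$ is the set of patterns with interval $[i,j]$. For $[k,l]\subseteq[i,j]$, $\alpha_{k:l}$ is the restriction of $\alpha$ to $[k,l]$ (a subpattern; a prefix if $k=i$, a suffix if $l=j$). Patterns $([i,j],v)$ and $([j+1,k],w)$ have concatenation $([i,k],vw)$; for a word $u$ and $\alpha=([i,j],v)$, $\alpha u=([i,j+|u|],vu)$. Whenever a concatenation is written it is assumed to be defined (to be a pattern). The symbol $*$ denotes an arbitrary (possibly empty) pattern, so $x=*\alpha*$ means that $\alpha$ is a subpattern of $x$. $\Pi^\circ$ is the set of all patterns $([i,j],w)$ with $w\in\Lambda$. Given real constants $c_\alpha$ ($\alpha\in\Pi^\circ$), $f(x)=\sum_{\alpha\in\Pi^\circ,\ x=*\alpha*}c_\alpha$ for every pattern $x$. $\Pi$ is the set of all prefixes (including empty ones) of patterns in $\Pi^\circ$; the empty patterns $\varepsilon_s$, $s\in[0,n]$, are taken to belong to $\Pi$. $\Pi_s=\{\alpha\in\Pi: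 j_\alpha=s\}$. For a pattern $\alpha$, $\mathrm{lsp}(\alpha)$ is the longest suffix of $\alpha$ belonging to $\Pi_{j_\alpha}$. For $\alpha,\beta\in\Pi$: $\beta\succ\alpha$ iff $j_\beta>j_\alpha$, $i_\beta\ge i_\alpha$ and $\alpha_{i_\beta:j_\alpha}=\beta_{i_\beta:j_\alpha}$ (the last condition holds by definition if $i_\beta>j_\alpha$). Grammar. $\Gamma=(D,N,S,R,\nu)$: terminals $D$, nonterminals $N$, initial symbol $S\in N$, rule set $R$, weights $\nu:R\to\mathbb R$. Chomsky Normal Form here means that every rule has one of the forms $A\to BC$ ($A,B,C\in N$), $A\to w$ ($A\in N$, $w\in D^*$), or $S\to\varepsilon$. The cost of a derivation is the sum of the weights of the rule applications in it, counted with multiplicity. For a pattern $x$, $C_\Gamma(x)$ is the cost of a least-weight derivation of the word of $x$ from $S$ ($+\infty$ if there is none). A minimum over the empty set is $+\infty$.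
   Formalization: Step 3 takes the minimum of the current value of M_A(α,β) and the displayed expression (literally it would erase step 2's values), and a nonterminal with a rule A→ε is assumed to occur in no right-hand side (else the procedure can miss derivations). *)

(* Defs.v *)
From HB Require Import structures.
From mathcomp Require Import all_boot all_order all_algebra.
From mathcomp Require Import finmap.
From mathcomp Require Import boolp classical_sets reals ereal.

Set Implicit Arguments.
Unset Strict Implicit.
Unset Printing Implicit Defensive.

Import Order.TTheory GRing.Theory Num.Theory.
Local Open Scope ring_scope.
Local Open Scope ereal_scope.

(* A pattern ([i,j], w) inside [1,n] is encoded as the pair (i - 1, w), with
   i - 1 in [0,n] and j = i - 1 + |w| <= n; for w = [::] this is the empty
   pattern eps_(i-1). *)
Definition pattern (n : nat) (D : finType) : finType :=
  {p : 'I_n.+1 * n.-bseq D | (p.1 + size p.2 <= n)%N}.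

Section Patterns.
Variables (n : nat) (D : finType).
Implicit Types (a b x : pattern n D) (L : {fset seq D}) (w : seq D).

Definition lo a : nat := (val a).1.+1.
Definition word a : seq D := (val a).2.
Definition hi a : nat := ((val a).1 + size (val a).2)%N.

(* The letters of a at the positions k, ..., l; empty when l < k.  It is the
   restriction a_{k:l} when [k,l] is a subinterval of [lo a, hi a]. *)
Definition restr a (k l : nat) : seq D :=
  take (l.+1 - k) (drop (k - lo a) (word a)).

Definition subpattern a x : bool :=
  [&& lo x <= lo a, hi a <= hi x & word a == restr x (lo a) (hi a)]%N.

Definition is_prefix a x : bool := (lo a == lo x) && subpattern a x.
Definition is_suffix a x : bool := (hi a == hi x) && subpattern a x.

(* D^{k:l} *)
Definition patterns_on (k l : nat) : {set pattern n D} :=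
  [set x | (lo x == k) && (hi x == l)].

Fact empty_pattern_subproof (s : 'I_n.+1) :
  ((s, [bseq] : n.-bseq D).1 + size (s, [bseq] : n.-bseq D).2 <= n)%N.
Proof. by rewrite addn0 -ltnS. Qed.

Definition eps (s : 'I_n.+1) : pattern n D :=
  exist _ (s, [bseq] : n.-bseq D) (empty_pattern_subproof s).

(* The concatenation a w; None when it does not fit in [1,n], i.e. when it is
   not a pattern. *)
Definition append a w : option (pattern n D) :=
  [pick b | (lo b == lo a) && (word b == word a ++ w)].

Definition Pi0 L : {set pattern n D} := [set a | word a \in L].

Definition Pi L : {set pattern n D} :=
  [set a | [exists b in Pi0 L, is_prefix a b] || (word a == [::])].

Definition Pi_at L (s : nat) : {set pattern n D} :=
  [set a in Pi L | hi a == s].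

Definition lsp L a : pattern n D :=
  [arg max_(b > eps (inord (hi a)) | (b \in Pi_at L (hi a)) && is_suffix b a)
     size (word b)].

(* b \succ a.  When lo b > hi a, both restrictions below are empty. *)
Definition follows L b a : bool :=
  [&& a \in Pi L, b \in Pi L, (hi a < hi b)%N, (lo a <= lo b)%N
    & restr a (lo b) (hi a) == restr b (lo b) (hi a)].

(* Only the values of c on Pi0 L are used. *)
Definition pattern_cost (R : realType) L (c : pattern n D -> R) x : R :=
  (\sum_(a in Pi0 L | subpattern a x) c a)%R.

End Patterns.

(* Symbols are nonterminals (inl) or terminals (inr); (A, s) is the rule
   A -> s.  Only the values of weight on the rules are used. *)
Record grammar (R : realType) (D N : finType) := Grammar {
  start : N;
  rules : {fset N * seq (N + D)};
  weight : N * seq (N + D) -> R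
}.

Section Grammars.
Variables (R : realType) (D N : finType).
Implicit Types (G : grammar R D N) (A B C : N) (w : seq D).

Definition terminals w : seq (N + D) := [seq inr d | d <- w].

Definition binary_rule A B C : N * seq (N + D) := (A, [:: inl B; inl C]).
Definition terminal_rule A w : N * seq (N + D) := (A, terminals w).

Definition chomsky_normal_form G : Prop :=
  forall r, r \in rules G ->
    [\/ exists A B C, r = binary_rule A B C,
        exists A w, r = terminal_rule A w
      | r = terminal_rule (start G) [::]].

(* The standard proviso on empty rules: a nonterminal with a rule A -> epsilon
   does not occur in any right-hand side.  Without it a nonempty word may have
   derivations of unboundedly negative cost. *)
Definition epsilon_rules_isolated G : Prop :=
  forall A, terminal_rule A [::] \in rules G ->
    forall r, r \in rules G -> inl A \notin r.2.

(* derivation G u v d: the sentential form u can be rewritten into v by a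
   sequence of rule applications whose weights add up to d. *)
Inductive derivation G : seq (N + D) -> seq (N + D) -> R -> Prop :=
| derivation_refl u : derivation G u u 0%R
| derivation_step u v A s t d :
    (A, s) \in rules G ->
    derivation G (u ++ s ++ v) t d ->
    derivation G (u ++ inl A :: v) t (weight G (A, s) + d)%R.

(* C_Gamma; +oo when w is not derivable.  Under chomsky_normal_form and
   epsilon_rules_isolated the infimum over a derivable w is a minimum, since
   the derivations of w have bounded length. *)
Definition grammar_cost G w : \bar R :=
  ereal_inf [set d%:E | d in [set d | derivation G [:: inl (start G)]
                                        (terminals w) d]].

End Grammars.

Arguments binary_rule {D N} A B C.

Definition enumerates (T : eqType) (P : T -> Prop) (s : seq T) : Prop :=
  uniq s /\ forall t, t \in s <-> P t.

Section Procedure.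
Variables (R : realType) (D N : finType) (n : nat).
Variables (L : {fset seq D}) (c : pattern n D -> R) (G : grammar R D N).

Local Notation pat := (pattern n D).
Local Notation f := (pattern_cost L c).

(* The messages M_A(a, b) are the entries with follows L b a.  The other
   entries are never read by step3 or result (for n >= 1). *)
Definition messages := N -> pat -> pat -> \bar R.

Definition step1 : messages := fun _ _ _ => +oo.

Definition step2_update (M : messages) (t : N * seq D * pat) : messages :=
  let: (A, w, a) := t in
  if append a w is Some aw then
    fun A' a' b' =>
      if [&& A' == A, a' == a & b' == lsp L aw]
      then (f aw + weight G (terminal_rule A w))%:E
      else M A' a' b'
  else M.

Definition step2 (order2 : seq (N * seq D * pat)) (M : messages) : messages :=
  foldl step2_update M order2.

Definition step2_index (t : N * seq D * pat) : Prop :=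
  let: (A, w, a) := t in terminal_rule A w \in rules G /\ a \in Pi n L.

(* The minimum is also taken with the current value of M_A(a, b), so that the
   value stored by step2 is not discarded. *)
Definition step3_update (M : messages) (p : pat * pat) : messages :=
  let: (a, b) := p in
  fun A a' b' =>
    if (a' == a) && (b' == b) then
      mine (M A a b)
        (\big[mine/+oo]_(q : N * N | binary_rule A q.1 q.2 \in rules G)
           \big[mine/+oo]_(g in Pi n L | follows L b g && follows L g a)
             (M q.1 a g + M q.2 g b - (f g)%:E
              + (weight G (binary_rule A q.1 q.2))%:E))
    else M A a' b'.

Definition step3 (order3 : seq (pat * pat)) (M : messages) : messages :=
  foldl step3_update M order3.

Definition step3_index (p : pat * pat) : Prop := follows L p.2 p.1.

Definition increasing_gap : rel (pat * pat) :=
  fun p q => (hi p.2 - hi p.1 <= hi q.2 - hi q.1)%N.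

Definition result (M : messages) : \bar R :=
  \big[mine/+oo]_(a in Pi_at n L n) M (start G) (eps D ord0) a.

Definition procedure (order2 : seq (N * seq D * pat))
    (order3 : seq (pat * pat)) : \bar R :=
  result (step3 order3 (step2 order2 step1)).

Definition total_cost (x : pat) : \bar R :=
  (f x)%:E + grammar_cost G (word x).

End Procedure.

(* Main.v *)
(* For a pattern x ending at position m let g = lsp x.  Since Pi is closed under
   prefixes, every occurrence in x u of a member of Pi that ends after m lies in
   g u (lemma subpattern_lsp_append).  Hence lsp (x u) = lsp (g u) and
   f (x u) = f x + f (g u) - f g, which is what the update of step 3 needs.
   Two bounds on the messages give the theorem.  Every finite message M_A(a, b)
   is f (a u) plus the cost of a parse of some word u from A with
   lsp (a u) = b; this is preserved by updates in any order.  Conversely, for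
   u nonempty, M_A(a, lsp (a u)) is at most f (a u) plus the cost of any parse
   of u from A, by induction along the order of increasing gaps. *)
Require Import Defs.
From HB Require Import structures.
From mathcomp Require Import all_boot all_order all_algebra.
From mathcomp Require Import finmap zify ring.
From mathcomp Require Import boolp classical_sets reals ereal.

Set Implicit Arguments.
Unset Strict Implicit.
Unset Printing Implicit Defensive.

Import Order.TTheory GRing.Theory Num.Theory.
Local Open Scope ring_scope.
Local Open Scope ereal_scope.

Lemma cat_inj (T : Type) (s1 s2 t1 t2 : seq T) :
  size s1 = size s2 -> s1 ++ t1 = s2 ++ t2 -> s1 = s2 /\ t1 = t2.
Proof.
move=> eqs eqst; split.
  by rewrite -(take_size_cat t1 (erefl (size s1))) eqst eqs take_size_cat.
by rewrite -(drop_size_cat t1 (erefl (size s1))) eqst eqs drop_size_cat.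
Qed.

(** * Positioned words: occurrences, prefixes, suffixes, concatenation *)

Section PatternTheory.
Variables (n : nat) (D : finType).
Implicit Types (a b g x y : pattern n D) (L : {fset seq D}) (u v w : seq D).

(** The start counted from zero: the end is then [off a + size (word a)], free of truncated
    subtraction. *)
Definition off a : nat := (val a).1.

Lemma loE a : lo a = (off a).+1.
Proof. by []. Qed.

Lemma hiE a : hi a = (off a + size (word a))%N.
Proof. by []. Qed.

Lemma hi_le a : (hi a <= n)%N.
Proof. exact: (valP a). Qed.

Lemma pattern_inj a b : off a = off b -> word a = word b -> a = b.
Proof.
case: a b => [[i u] lei] [[j v] lej]; rewrite /off /word /= => eqij equv.
by apply: val_inj; congr pair; apply: val_inj.
Qed.

Lemma pattern_exists (k : nat) w :
  (k + size w <= n)%N -> exists a, off a = k /\ word a = w.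
Proof.
move=> le_kw; have ltk : (k < n.+1)%N by lia.
have lew : (size w <= n)%N by lia.
by exists (exist _ (Ordinal ltk, Bseq lew) le_kw).
Qed.

(** Factorizations of the word replace restrictions to intervals, so that later arguments can cancel
    concatenations. *)
Lemma subpatternP a x :
  reflect (exists u v, word x = u ++ word a ++ v /\ off a = (off x + size u)%N)
          (subpattern a x).
Proof.
rewrite /subpattern /restr; apply: (iffP and3P).
- rewrite !loE !hiE => -[ltxa leax /eqP eqa].
  exists (take (off a - off x) (word x)).
  exists (drop (size (word a)) (drop (off a - off x) (word x))).
  split; last by rewrite size_take_min; lia.
  have -> : word a = take (size (word a)) (drop (off a - off x) (word x)).
    by rewrite [LHS]eqa; congr take; lia.
  rewrite [in drop (size _) _]size_take_min size_drop.
  rewrite (_ : minn _ _ = size (word a)); last by lia.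
  by rewrite !cat_take_drop.
- move=> [u [v [eqx eqa]]].
  have sx : size (word x) = (size u + (size (word a) + size v))%N.
    by rewrite eqx !size_cat.
  rewrite !loE !hiE; split; [lia | lia |].
  have -> : ((off a + size (word a)).+1 - (off a).+1 = size (word a))%N by lia.
  have -> : ((off a).+1 - (off x).+1 = size u)%N by lia.
  by rewrite eqx drop_size_cat // take_size_cat.
Qed.

Lemma is_suffixP b a :
  reflect (hi b = hi a /\ exists v, word a = v ++ word b) (is_suffix b a).
Proof.
apply: (iffP andP) => [[/eqP eqh /subpatternP[u [v [eqa eqo]]]] | [eqh [v eqa]]].
- split=> //; exists u; rewrite eqa; case: v eqa => [|d v] eqa.
    by rewrite cats0.
  by move: eqh; rewrite !hiE eqa !size_cat /=; lia.
- split; first exact/eqP.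
  apply/subpatternP; exists v, [::]; rewrite cats0; split=> //.
  by move: eqh; rewrite !hiE eqa size_cat; lia.
Qed.

Lemma is_prefixP b a :
  reflect (off b = off a /\ exists v, word a = word b ++ v) (is_prefix b a).
Proof.
apply: (iffP andP) => [[/eqP[eqo] /subpatternP[u [v [eqa eqo']]]] | [eqo [v eqa]]].
- rewrite -/(off b) -/(off a) in eqo; split=> //; exists v.
  have u0 : u = [::] by apply: size0nil; lia.
  by rewrite eqa u0.
- split; first by rewrite !loE eqo.
  by apply/subpatternP; exists [::], v; rewrite eqo addn0.
Qed.

(** Reduces the equality of two longest suffixes to a comparison of lengths. *)
Lemma suffix_same_size a b x :
  is_suffix a x -> is_suffix b x -> size (word a) = size (word b) -> a = b.
Proof.
move=> /is_suffixP[ha [u eqa]] /is_suffixP[hb [v eqb]] eqs.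
apply: pattern_inj; first by move: ha hb; rewrite !hiE; lia.
have euv : u ++ word a = v ++ word b by rewrite -eqa -eqb.
have [|_ //] := cat_inj _ euv.
by have := congr1 size euv; rewrite !size_cat eqs; lia.
Qed.

Lemma suffix_lsize a b x :
  is_suffix a x -> is_suffix b x -> (size (word a) <= size (word b))%N ->
  is_suffix a b.
Proof.
move=> /is_suffixP[ha [u eqa]] /is_suffixP[hb [v eqb]] les.
apply/is_suffixP; split; first by rewrite ha hb.
exists (drop (size v) u).
have sz : (size u + size (word a) = size v + size (word b))%N.
  by rewrite -!size_cat -eqa -eqb.
have: drop (size v) (word x) = word b by rewrite eqb drop_size_cat.
rewrite eqa drop_cat; case: ltnP => [//|le_uv].
have -> : size v = size u by move: sz; lia.
by rewrite subnn drop0 => <-; rewrite drop_size.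
Qed.

Lemma is_suffix_trans a b x : is_suffix a b -> is_suffix b x -> is_suffix a x.
Proof.
move=> /is_suffixP[ha [u eqb]] /is_suffixP[hb [v eqx]].
apply/is_suffixP; split; first by rewrite ha.
by exists (v ++ u); rewrite eqx eqb catA.
Qed.

Lemma appendP a w b :
  append a w = Some b <-> off b = off a /\ word b = word a ++ w.
Proof.
rewrite /append; split.
  by case: pickP => // b' /andP[/eqP[? ] /eqP ?] [<-].
move=> [eqo eqw]; case: pickP => [b' /andP[/eqP[eqo'] /eqP eqw'] | /(_ b)].
  by congr Some; apply: pattern_inj; [rewrite eqo | rewrite eqw'].
by rewrite !loE eqo eqw !eqxx.
Qed.

Lemma hi_append a w b : append a w = Some b -> hi b = (hi a + size w)%N.
Proof. by move/appendP=> [eqo eqw]; rewrite !hiE eqo eqw size_cat; lia. Qed.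

Lemma append_exists a w :
  (hi a + size w <= n)%N -> exists b, append a w = Some b.
Proof.
move=> le_n; have [|b [eqo eqw]] := @pattern_exists (off a) (word a ++ w).
  by move: le_n; rewrite hiE size_cat; lia.
by exists b; apply/appendP.
Qed.

Lemma is_suffix_append g x u y z :
  is_suffix g x -> append g u = Some y -> append x u = Some z -> is_suffix y z.
Proof.
move=> /is_suffixP[hg [v eqx]] gu xu.
apply/is_suffixP; split; first by rewrite (hi_append gu) (hi_append xu) hg.
move/appendP: gu => [_ ->]; move/appendP: xu => [_ ->].
by exists v; rewrite eqx catA.
Qed.

(** * The prefix-closed set [Pi] and longest suffixes in it *)

Lemma PiP L a :
  reflect ((exists b, word b \in L /\ is_prefix a b) \/ word a = [::])
          (a \in Pi n L).
Proof.
rewrite inE; apply: (iffP orP) => -[].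
- by case/existsP=> b /andP[]; rewrite inE => bL pab; left; exists b.
- by move/eqP; right.
- by case=> b [bL pab]; left; apply/existsP; exists b; rewrite inE bL.
- by move->; right.
Qed.

Lemma Pi_prefix L a b : b \in Pi n L -> is_prefix a b -> a \in Pi n L.
Proof.
move=> /PiP[[x [xL /is_prefixP[eqbx [v eqx]]]]|eb] /is_prefixP[eqab [u equ]];
  apply/PiP; [left | right].
- exists x; split=> //; apply/is_prefixP; split; first by rewrite eqab.
  by exists (u ++ v); rewrite eqx equ catA.
- by move: equ; rewrite eb; case: (word a).
Qed.

Lemma Pi_word L a : word a \in L -> a \in Pi n L.
Proof.
move=> aL; apply/PiP; left; exists a; split=> //.
by apply/is_prefixP; split=> //; exists [::]; rewrite cats0.
Qed.

Lemma Pi_eps L s : eps D s \in Pi n L.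
Proof. by apply/PiP; right. Qed.

Lemma hi_eps (s : 'I_n.+1) : hi (eps D s) = s.
Proof. exact: addn0. Qed.

Lemma lspP L a :
  [/\ lsp L a \in Pi n L, is_suffix (lsp L a) a &
      forall b, b \in Pi n L -> is_suffix b a ->
        (size (word b) <= size (word (lsp L a)))%N].
Proof.
rewrite /lsp; case: arg_maxnP => [|g].
  (* The default of the arg max must itself be a candidate: the empty pattern at the end of [a] is a
     suffix of [a] lying in [Pi]. *)
  have hie : hi (eps D (inord (hi a) : 'I_n.+1)) = hi a.
    by rewrite hi_eps inordK // ltnS hi_le.
  rewrite inE Pi_eps hie eqxx /=; apply/is_suffixP; split=> //.
  by exists (word a); rewrite cats0.
case/andP; rewrite inE => /andP[gPi _] sga max_g; split=> // b bPi sba.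
apply: max_g; rewrite inE bPi sba /= andbT; apply/eqP.
by case/is_suffixP: sba.
Qed.

Lemma lsp_Pi L a : lsp L a \in Pi n L.
Proof. by have [] := lspP L a. Qed.

Lemma lsp_suffix L a : is_suffix (lsp L a) a.
Proof. by have [] := lspP L a. Qed.

Lemma lsp_max L a b :
  b \in Pi n L -> is_suffix b a -> (size (word b) <= size (word (lsp L a)))%N.
Proof. by have [_ _] := lspP L a; apply. Qed.

Lemma hi_lsp L a : hi (lsp L a) = hi a.
Proof. by case/is_suffixP: (lsp_suffix L a). Qed.

(* A member of Pi ending to the right of x and starting inside x restricts to a
   suffix of x, and that suffix is in Pi because Pi is prefix-closed. *)
Lemma lsp_covers L x u z a b :
  append x u = Some z -> b \in Pi n L -> is_prefix a b ->
  subpattern b z -> hi a = hi x -> is_suffix a (lsp L x).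
Proof.
move=> /appendP[eqo eqz] bPi pab /subpatternP[v [t [eqb eqv]]] eqh.
have aPi := Pi_prefix bPi pab.
case/is_prefixP: pab => eqa [s eqs].
have sax : is_suffix a x.
  apply/is_suffixP; split=> //; exists v.
  move: eqb; rewrite eqz eqs -catA catA => /cat_inj[] //.
  by move: eqh; rewrite !hiE size_cat; lia.
exact: suffix_lsize sax (lsp_suffix L x) (lsp_max aPi sax).
Qed.

(** If [b] starts after the end of [x], this follows from [hi_lsp]. Otherwise cutting [b] at the end
    of [x] gives a prefix of [b], to which [lsp_covers] applies. *)
Lemma off_lsp_le L x u z b :
  append x u = Some z -> b \in Pi n L -> subpattern b z ->
  (hi x < hi b)%N -> (off (lsp L x) <= off b)%N.
Proof.
move=> xu bPi sbz lt_xb.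
have := hi_lsp L x; rewrite hiE => hil.
have [le_xb|lt_bx] := leqP (hi x) (off b); first by lia.
have [|a [eqo eqa]] :=
    @pattern_exists (off b) (take (hi x - off b) (word b)).
  have := hi_le b; have := hi_le x; rewrite size_take_min; lia.
have pab : is_prefix a b.
  apply/is_prefixP; split=> //; exists (drop (hi x - off b) (word b)).
  by rewrite eqa cat_take_drop.
have eqh : hi a = hi x.
  by move: lt_xb; rewrite [hi a]hiE [hi b]hiE eqo eqa size_take_min; lia.
have /is_suffixP[_ [v eqv]] := lsp_covers xu bPi pab sbz eqh.
move: eqh hil; rewrite hiE eqv size_cat eqo; lia.
Qed.

Lemma subpattern_lsp_append L x u y z b :
  append x u = Some z -> append (lsp L x) u = Some y -> b \in Pi n L ->
  (hi x < hi b)%N -> subpattern b z = subpattern b y.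
Proof.
move=> xu gu bPi lt_xb.
have /is_suffixP[hyz [v eqz]] := is_suffix_append (lsp_suffix L x) gu xu.
move: (gu) (xu) => /appendP[eqy _] /appendP[eqoz _].
have offyz : off y = (off z + size v)%N.
  by move: hyz; rewrite !hiE eqz size_cat; lia.
apply/idP/idP.
- move=> sbz; have := off_lsp_le xu bPi sbz lt_xb; rewrite -eqy => le_yb.
  case/subpatternP: sbz => p [q [eqz' eqb]].
  (* [v] is the part of [z] to the left of [y]. The occurrence starts inside [y], so [v] can be
     removed from its left context [p]. *)
  apply/subpatternP; exists (drop (size v) p), q.
  have le_vp : (size v <= size p)%N by lia.
  split; last by rewrite size_drop; lia.
  have : drop (size v) (word z) = word y by rewrite eqz drop_size_cat.
  rewrite eqz' drop_cat; case: ltnP => [_ <- //|le_pv <-].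
  by rewrite (_ : size v = size p) ?subnn ?drop0 ?drop_size //; lia.
- case/subpatternP=> p [q [eqy' eqb]]; apply/subpatternP; exists (v ++ p), q.
  by rewrite eqz eqy' -!catA size_cat; split=> //; lia.
Qed.

Lemma is_suffix_refl a : is_suffix a a.
Proof. by apply/is_suffixP; split=> //; exists [::]. Qed.

(** Both sides are suffixes of [z], and [lsp L y] competes for [lsp L z]. Conversely, when [lsp L z]
    ends after [x], it already lies in [y]. *)
Lemma lsp_append L x u y z :
  append x u = Some z -> append (lsp L x) u = Some y -> lsp L y = lsp L z.
Proof.
move=> xu gu; have syz := is_suffix_append (lsp_suffix L x) gu xu.
have sly := is_suffix_trans (lsp_suffix L y) syz.
apply: (suffix_same_size sly (lsp_suffix L z)); apply/eqP.
rewrite eqn_leq lsp_max ?lsp_Pi //=.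
have [lt_x|le_x] := ltnP (hi x) (hi (lsp L z)).
  have /andP[_] := lsp_suffix L z.
  rewrite (subpattern_lsp_append xu gu (lsp_Pi L z) lt_x) => sub.
  apply: lsp_max; first exact: lsp_Pi.
  rewrite /is_suffix sub andbT hi_lsp; apply/eqP.
  by case/is_suffixP: syz.
(* [lsp L z] ends where [z] does, so here [u] adds nothing to [x]. *)
have u0 : u = [::].
  apply: size0nil; move: le_x; rewrite hi_lsp (hi_append xu); lia.
move: xu gu; rewrite u0 => /appendP[eo ew] /appendP[eo' ew'].
rewrite cats0 in ew; rewrite cats0 in ew'.
have -> : z = x by apply: pattern_inj.
have -> : y = lsp L x by apply: pattern_inj.
by apply: lsp_max; [apply: lsp_Pi | apply: is_suffix_refl].
Qed.

Lemma append_cat a u v x z :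
  append a u = Some x -> append a (u ++ v) = Some z -> append x v = Some z.
Proof.
move=> /appendP[eqo eqw] /appendP[eqo' eqw']; apply/appendP.
by rewrite eqo' eqo eqw' eqw catA.
Qed.

Lemma append_append a u v x z :
  append a u = Some x -> append x v = Some z -> append a (u ++ v) = Some z.
Proof.
move=> /appendP[eqo eqw] /appendP[eqo' eqw']; apply/appendP.
by rewrite eqo' eqo eqw' eqw catA.
Qed.

(** Guarantees that [(a, lsp L x)] indexes a message. Agreement on the overlap holds since [a] is a
    prefix and [lsp L x] a suffix of the same [x]; a nonempty [u] makes the end increase
    strictly. *)
Lemma follows_lsp L a u x :
  a \in Pi n L -> u <> [::] -> append a u = Some x -> follows L (lsp L x) a.
Proof.
move=> aPi u0 au; rewrite /follows aPi lsp_Pi /=.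
have /is_suffixP[_ [v eqx]] := lsp_suffix L x.
rewrite hi_lsp (hi_append au).
have := hi_lsp L x; rewrite (hi_append au) 2!hiE => hil.
move/appendP: au => [eqo eqw].
have eqv : word a ++ u = v ++ word (lsp L x) by rewrite -eqw.
have := congr1 size eqv; rewrite !size_cat => sz.
apply/and3P; split.
- by case: u u0 {eqw eqv sz hil} => //= d u _; lia.
- by rewrite !loE; lia.
rewrite /restr subnn drop0 !loE; set k := ((hi a).+1 - _)%N.
(* [k] is the length of the overlap; when [v] is longer than [a] there is no overlap and both
   restrictions are empty. *)
have [le_va|lt_av] := leqP (size v) (size (word a)); last first.
  by rewrite (_ : k = 0)%N ?take0 // /k hiE; lia.
have -> : ((off (lsp L x)).+1 - (off a).+1 = size v)%N by lia.
have <- : drop (size v) (word a ++ u) = word (lsp L x).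
  by rewrite eqv drop_size_cat.
have -> : drop (size v) (word a ++ u) = drop (size v) (word a) ++ u.
  rewrite drop_cat; case: ltnP => // le_av.
  have -> : size v = size (word a) by lia.
  by rewrite subnn drop0 drop_size.
rewrite takel_cat // size_drop /k hiE; lia.
Qed.

(** [w] placed right after [a] is itself a suffix of [x] in [Pi], so the longest one extends it to
    the left. *)
Lemma lsp_append_suffix L a w x :
  w \in L -> append a w = Some x ->
  exists v, word (lsp L x) = v ++ w.
Proof.
move=> wL aw; have hx := hi_append aw; have hn := hi_le x.
have [|b [eqo eqb]] := @pattern_exists (hi a) w; first by lia.
have sbx : is_suffix b x.
  apply/is_suffixP; split; first by rewrite hx hiE eqo eqb.
  by exists (word a); move/appendP: aw => [_ ->]; rewrite eqb.
have bPi : b \in Pi n L by apply: Pi_word; rewrite eqb.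
have /is_suffixP[_ [v]] :=
  suffix_lsize sbx (lsp_suffix L x) (lsp_max bPi sbx).
by rewrite eqb; exists v.
Qed.

(** Equal longest suffixes have equal ends, so [w] and [w'] have one length and are tails of the
    same word. *)
Lemma lsp_append_inj L a w w' x x' :
  w \in L -> w' \in L -> append a w = Some x -> append a w' = Some x' ->
  lsp L x = lsp L x' -> w = w'.
Proof.
move=> wL w'L aw aw' eqx.
have [v eqv] := lsp_append_suffix wL aw.
have [v' eqv'] := lsp_append_suffix w'L aw'.
have evv : v ++ w = v' ++ w' by rewrite -eqv -eqv' eqx.
have := congr1 (@hi n D) eqx.
rewrite !hi_lsp (hi_append aw) (hi_append aw') => eqs.
have [|_ //] := cat_inj _ evv.
by have := congr1 size evv; rewrite !size_cat; lia.
Qed.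

(** * Pattern cost under concatenation *)

Section Cost.
Variables (R : realType) (L : {fset seq D}) (c : pattern n D -> R).
Local Notation f := (pattern_cost L c).

(** Occurrences in [z] are split by their end; those ending no later than [x] are exactly the
    occurrences in [x]. *)
Lemma pattern_cost_append x u z :
  append x u = Some z ->
  f z = (f x + \sum_(a in Pi0 n L | subpattern a z && (hi x < hi a)%N) c a)%R.
Proof.
move=> xu; rewrite /pattern_cost (bigID (fun a => hi a <= hi x)%N) /=.
congr (_ + _)%R; apply: eq_bigl => a; rewrite -andbA -?ltnNge //.
congr andb.
move/appendP: xu => [eqo eqz]; apply/andP/idP => [[]|].
- case/subpatternP=> p [q [eqp eqa]] le_ax; apply/subpatternP.
  (* The occurrence ends inside [x], so only its right context [q] has to be cut at the end of
     [x]. *)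
  exists p, (take (size (word x) - size (p ++ word a)) q).
  split; last by rewrite eqa eqo.
  have : take (size (word x)) (word z) = word x by rewrite eqz take_size_cat.
  rewrite eqp catA take_cat; case: ltnP => [|_ eqx]; last by rewrite catA eqx.
  by move: le_ax; rewrite !hiE size_cat; lia.
- case/subpatternP=> p [q [eqp eqa]]; split.
    apply/subpatternP; exists p, (q ++ u).
    by rewrite eqz eqp -!catA eqo.
  by rewrite !hiE eqp !size_cat; lia.
Qed.

(** Appending [u] to [x] and to [lsp L x] creates the same new occurrences, by
    [subpattern_lsp_append]. *)
Lemma pattern_cost_lsp_append x u y z :
  append x u = Some z -> append (lsp L x) u = Some y ->
  f z = (f x + f y - f (lsp L x))%R.
Proof.
move=> xu gu; rewrite (pattern_cost_append xu) (pattern_cost_append gu).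
rewrite [(f (lsp L x) + _)%R]addrC -addrA addrK; congr (_ + _)%R.
apply: eq_bigl => a; rewrite hi_lsp; case aL: (a \in Pi0 n L) => //=.
case: ltnP => [lt_xa|]; last by rewrite !andbF.
rewrite !andbT; apply: (subpattern_lsp_append xu gu) => //.
by apply: Pi_word; rewrite inE in aL.
Qed.

End Cost.
End PatternTheory.

(** * Parse trees and derivations *)

Section Parsing.
Variables (R : realType) (D N : finType) (G : grammar R D N).
Implicit Types (A B C : N) (w : seq D) (s u v : seq (N + D)).

(** Weighted parse trees, which forget the order of rule applications and expose how the root rule
    splits the word. *)
Inductive parse : N -> seq D -> R -> Prop :=
| parse_terminal A w :
    terminal_rule A w \in rules G -> parse A w (weight G (terminal_rule A w))
| parse_binary A B C w1 w2 d1 d2 :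
    binary_rule A B C \in rules G -> parse B w1 d1 -> parse C w2 d2 ->
    parse A (w1 ++ w2) (weight G (binary_rule A B C) + d1 + d2)%R.

(** Forests over a sentential form: the invariant for induction on derivations, whose intermediate
    forms are arbitrary. *)
Inductive parse_form : seq (N + D) -> seq D -> R -> Prop :=
| parse_form_nil : parse_form [::] [::] 0%R
| parse_form_inr x s w d :
    parse_form s w d -> parse_form (inr x :: s) (x :: w) d
| parse_form_inl A s w1 w2 d1 d2 :
    parse A w1 d1 -> parse_form s w2 d2 ->
    parse_form (inl A :: s) (w1 ++ w2) (d1 + d2)%R.

(** The context [u], [v] and the remaining derivation are general, so that subtrees can be unfolded
    one after the other without composing derivations. *)
Lemma parse_derivation A w d u v t e :
  parse A w d -> derivation G (u ++ terminals N w ++ v) t e ->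
  derivation G (u ++ inl A :: v) t (d + e)%R.
Proof.
move=> p; elim: p u v t e => {A w d} [A w Aw|A B C w1 w2 d1 d2 ABC _ IH1 _ IH2] u v t e der.
  exact: derivation_step.
rewrite -!addrA; apply: derivation_step ABC _.
(* [B] is expanded first; its yield then joins the left context of [C]. *)
apply: (IH1 u (inl C :: v)); rewrite catA; apply: IH2.
by move: der; rewrite /terminals map_cat -!catA.
Qed.

Lemma parse_form_cat s1 s2 w d :
  parse_form (s1 ++ s2) w d ->
  exists w1 w2 d1 d2, [/\ parse_form s1 w1 d1, parse_form s2 w2 d2,
    w = w1 ++ w2 & d = (d1 + d2)%R].
Proof.
elim: s1 w d => [|[A|x] s1 IH] w d /= p.
- by exists [::], w, 0%R, d; split=> //; [constructor | rewrite add0r].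
- inversion p as [| |A' s w1 w2 d1 d2 pA ps]; subst.
  have [v1 [v2 [e1 [e2 [p1 p2 -> ->]]]]] := IH _ _ ps.
  exists (w1 ++ v1), v2, (d1 + e1)%R, e2; rewrite catA addrA; split=> //.
  by constructor.
- inversion p as [|x' s w' d' ps|]; subst.
  have [v1 [v2 [e1 [e2 [p1 p2 -> ->]]]]] := IH _ _ ps.
  by exists (x :: v1), v2, e1, e2; split=> //; constructor.
Qed.

Lemma cat_parse_form s1 s2 w1 w2 d1 d2 :
  parse_form s1 w1 d1 -> parse_form s2 w2 d2 ->
  parse_form (s1 ++ s2) (w1 ++ w2) (d1 + d2)%R.
Proof.
move=> p1 p2; elim: p1 => {s1 w1 d1} [|x s w d _ IH|A s v1 v2 e1 e2 pA _ IH] /=.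
- by rewrite add0r.
- by constructor.
- by rewrite -catA -addrA; constructor.
Qed.

Lemma parse_form_terminals w w' d :
  parse_form (terminals N w) w' d -> w' = w /\ d = 0%R.
Proof.
elim: w w' d => [|x w IH] w' d p; inversion p as [|x' s v e ps|]; subst=> //.
by have [-> ->] := IH _ _ ps.
Qed.

Lemma terminals_parse_form w : parse_form (terminals N w) w 0%R.
Proof. by elim: w => [|x w IH]; constructor. Qed.

Lemma parse_form1 A w d : parse_form [:: inl A] w d -> parse A w d.
Proof.
move=> p; inversion p as [| |A' s w1 w2 d1 d2 pA ps]; subst.
by inversion ps; subst; rewrite cats0 addr0.
Qed.

Hypothesis cnf : chomsky_normal_form G.

(** Folds a forest over a right-hand side into a tree. Normal form leaves two shapes, the rule from
    the start symbol to the empty word being a terminal one. *)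
Lemma parse_rule A s w d :
  (A, s) \in rules G -> parse_form s w d -> parse A w (weight G (A, s) + d)%R.
Proof.
move=> As; have cases : (exists B C, (A, s) = binary_rule A B C) \/
    exists w', (A, s) = terminal_rule A w'.
  case: (cnf As) => [[A' [B [C eqr]]]|[A' [w' eqr]]|eqr].
  - by left; exists B, C; rewrite eqr; case: eqr => <-.
  - by right; exists w'; rewrite eqr; case: eqr => <-.
  - by right; exists [::]; rewrite eqr; case: eqr => <-.
case: cases => [[B [C eqr]]|[w' eqr]] p.
- move: (As) p; rewrite eqr; case: eqr => -> ABC p.
  have [w1 [w2 [d1 [d2 [/parse_form1 p1 /parse_form1 p2 -> ->]]]]] :=
    @parse_form_cat [:: inl B] [:: inl C] _ _ p.
  by rewrite addrA; apply: parse_binary.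
- move: (As) p; rewrite eqr; case: eqr => -> Aw p.
  have [-> ->] := parse_form_terminals p; rewrite addr0.
  exact: parse_terminal.
Qed.

Lemma derivation_parse_form s w d :
  derivation G s (terminals N w) d -> parse_form s w d.
Proof.
move eqt: (terminals N w) => t der; elim: der eqt => {s t d} [s|u v A s t d As _ IH] eqt.
  by rewrite -eqt; apply: terminals_parse_form.
(* The forest over [u ++ s ++ v] is cut in three, and the piece over [s] becomes one tree rooted at
   [A]. *)
have [w1 [w23 [d1 [d23 [p1 p23 -> ->]]]]] := parse_form_cat (IH eqt).
have [w2 [w3 [d2 [d3 [p2 p3 -> ->]]]]] := parse_form_cat p23.
have -> : (weight G (A, s) + (d1 + (d2 + d3)) =
           d1 + ((weight G (A, s) + d2) + d3))%R.
  by rewrite addrCA -addrA.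
by apply: cat_parse_form p1 _; constructor=> //; apply: parse_rule.
Qed.

Lemma derivationP A w d :
  derivation G [:: inl A] (terminals N w) d <-> parse A w d.
Proof.
split=> [der|p]; first exact/parse_form1/derivation_parse_form.
rewrite -[d]addr0; apply: (@parse_derivation _ _ _ [::] [::]) p _.
by rewrite cats0; constructor.
Qed.

Hypothesis eps_isolated : epsilon_rules_isolated G.

(** Induction along the leftmost branch: every node on it occurs in some right-hand side, so its
    final leaf cannot use an empty rule. *)
Lemma parse_neq0 A w d :
  (exists2 r, r \in rules G & inl A \in r.2) -> parse A w d -> w <> [::].
Proof.
move=> occ p; elim: p occ => {A w d} [A w Aw|A B' C' w1 w2 d1 d2 ABC _ IH1 _ _] occ.
  move=> w0; case: occ => r rG; apply/negP; apply: eps_isolated rG.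
  by rewrite -w0.
have /IH1 : exists2 r, r \in rules G & inl B' \in r.2.
  by exists (binary_rule A B' C') => //=; rewrite !inE eqxx.
by case: (w1).
Qed.

End Parsing.

(** * Soundness of the messages *)

Section Messages.
Variables (R : realType) (D N : finType) (n : nat).
Variables (L : {fset seq D}) (c : pattern n D -> R) (G : grammar R D N).
Local Notation pat := (pattern n D).
Local Notation f := (pattern_cost L c).
Local Notation msgs := (messages R D N n).
Implicit Types (M : msgs) (a b g x : pat) (A B C : N) (u w : seq D).

Definition attained_value A a b (m : \bar R) : Prop := m = +oo \/
  exists u d x, [/\ append a u = Some x, parse G A u d, lsp L x = b &
                   m = (f x + d)%:E].

Definition attained M : Prop := forall A a b, attained_value A a b (M A a b).

(** An empty [u] is excluded: then [lsp L x] ends where [a] does, so the pair is not related by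
    [follows]. *)
Definition optimal M a b : Prop := forall A u d x,
  u <> [::] -> parse G A u d -> append a u = Some x -> lsp L x = b ->
  M A a b <= (f x + d)%:E.

Lemma attained_min A a b m1 m2 :
  attained_value A a b m1 -> attained_value A a b m2 ->
  attained_value A a b (mine m1 m2).
Proof. by rewrite minEle; case: ifP. Qed.

Lemma attained_bigmin A a b (I : finType) (P : pred I) (F : I -> \bar R) :
  (forall i, P i -> attained_value A a b (F i)) ->
  attained_value A a b (\big[mine/+oo]_(i | P i) F i).
Proof. by move=> attF; apply: big_ind => //; [left | exact: attained_min]. Qed.

Lemma step2_attained order2 :
  (forall t, t \in order2 -> step2_index L G t) ->
  attained (step2 L c G order2 (@step1 R D N n)).
Proof.
rewrite /step2; elim/last_ind: order2 => [|s [[A w] a] IH] sub A' a' b' /=.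
  by left.
rewrite -cats1 foldl_cat /=.
have [|Aw _] := sub (A, w, a); first by rewrite mem_rcons inE eqxx.
have {}IH : attained (foldl (step2_update L c G) (@step1 R D N n) s).
  by apply: IH => t ts; apply: sub; rewrite mem_rcons inE ts orbT.
case eqx: (append a w) => [x|]; last exact: IH.
case: ifP => [/and3P[/eqP-> /eqP-> /eqP->]|_].
  by right; exists w, (weight G (terminal_rule A w)), x; split=> //; constructor.
exact: IH.
Qed.

Lemma step3_update_attained M p : attained M -> attained (step3_update L c G M p).
Proof.
case: p => a b attM A a' b' /=; case: ifP => [/andP[/eqP-> /eqP->]|_] //.
apply: attained_min; first exact: attM.
apply: attained_bigmin => -[B C] /= ABC; apply: attained_bigmin => g _.
(* Attained values are never [-oo], so one infinite message makes the whole sum [+oo]. *)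
have [->|[u1 [d1 [x1 [au1 p1 lx1 ->]]]]] := attM B a g.
  by left; have [->|[u2 [d2 [x2 [_ _ _ ->]]]]] := attM C g b.
have [->|[u2 [d2 [x2 [gu2 p2 lx2 ->]]]]] := attM C g b; first by left.
(* [u2] was parsed after [g = lsp L x1], which ends where [x1] does; hence it also fits after
   [x1]. *)
right; have [|x x1u2] := @append_exists _ _ x1 u2.
  rewrite -(hi_lsp L) lx1 -(hi_append gu2); exact: hi_le.
exists (u1 ++ u2), (weight G (binary_rule A B C) + d1 + d2)%R, x; split.
- exact: append_append au1 x1u2.
- exact: parse_binary.
- by rewrite -lx2; apply/esym/(lsp_append x1u2); rewrite lx1.
- rewrite -lx1 in gu2; rewrite (pattern_cost_lsp_append c x1u2 gu2) lx1.
  by rewrite -!(EFinN, EFinD); congr EFin; ring.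
Qed.

Lemma step3_attained order3 M : attained M -> attained (step3 L c G order3 M).
Proof.
rewrite /step3; elim: order3 M => //= p s IH M attM.
exact/IH/step3_update_attained.
Qed.

(** The old entry takes part in the minimum, so upper bounds on messages survive all later
    updates. *)
Lemma step3_update_le M p A a b : step3_update L c G M p A a b <= M A a b.
Proof.
case: p => a' b' /=; case: ifP => [/andP[/eqP-> /eqP->]|_] //.
by rewrite ge_min lexx.
Qed.

Lemma step3_le order3 M A a b : step3 L c G order3 M A a b <= M A a b.
Proof.
rewrite /step3; elim: order3 M => //= p s IH M.
exact: le_trans (IH _) (step3_update_le _ _ _ _ _).
Qed.

(** * Optimality of the messages *)

Hypothesis terminal_L : forall A w, terminal_rule A w \in rules G ->
  w \in L \/ (A = start G /\ w = [::]).

Lemma terminal_in_L A w : terminal_rule A w \in rules G -> w <> [::] -> w \in L.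
Proof. by move=> /terminal_L[|[_]]. Qed.

(* No later assignment of step 2 overwrites the entry with another value:
   lsp (a w) ends in w, so w is determined by a and lsp (a w). *)
Lemma step2_terminal order2 A w a x :
  (forall t, t \in order2 -> step2_index L G t) ->
  (A, w, a) \in order2 -> w <> [::] -> append a w = Some x ->
  step2 L c G order2 (@step1 R D N n) A a (lsp L x) =
    (f x + weight G (terminal_rule A w))%:E.
Proof.
move=> + + w0 aw; rewrite /step2.
elim/last_ind: order2 => [|s [[A' w'] a'] IH] sub //.
have subs : forall t, t \in s -> step2_index L G t.
  by move=> t ts; apply: sub; rewrite mem_rcons inE ts orbT.
have rulesL t : t \in rcons s (A', w', a') -> terminal_rule t.1.1 t.1.2 \in rules G.
  by case: t => [[B v] b] /sub[].
move=> tin; rewrite -cats1 foldl_cat /=.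
have [eqt|neqt] := eqVneq (A, w, a) (A', w', a').
  by case: eqt => <- <- <-; rewrite aw !eqxx.
have {}IH := IH subs; move: (tin); rewrite mem_rcons inE (negPf neqt) /= => /IH eqM.
case aw': (append a' w') => [x'|] //; case: ifP => // /and3P[/eqP eA /eqP ea /eqP eqx].
subst A' a'; exfalso; move/eqP: neqt; apply; congr (_, _, _).
have w'0 : w' <> [::].
  move=> w'0; have := congr1 (@hi n D) eqx.
  rewrite !hi_lsp (hi_append aw) (hi_append aw') w'0 addn0.
  by case: (w) w0 => //= *; lia.
apply: (lsp_append_inj _ _ aw aw' eqx).
  exact: (terminal_in_L (rulesL _ tin)).
by apply: (terminal_in_L (rulesL (A, w', a) _)) => //; rewrite mem_rcons inE eqxx.
Qed.

Hypothesis eps_isolated : epsilon_rules_isolated G.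

(** Case on the root rule. A terminal root is bounded by the current entry, a binary one by the
    candidate [g = lsp L x1] with [x1] the pattern [a w1]; both messages through [g] have smaller
    gaps because [w1] and [w2] are nonempty. *)
Lemma step3_update_optimal M a b :
  a \in Pi n L ->
  (forall A w x, terminal_rule A w \in rules G -> w <> [::] ->
     append a w = Some x -> lsp L x = b ->
     M A a b <= (f x + weight G (terminal_rule A w))%:E) ->
  (forall p, follows L p.2 p.1 -> (hi p.2 - hi p.1 < hi b - hi a)%N ->
     optimal M p.1 p.2) ->
  optimal (step3_update L c G M (a, b)) a b.
Proof.
move=> aPi term optM A u d x u0 p; rewrite /= !eqxx /=.
case: p u0 x => {A u d} [A w Aw|A B C w1 w2 d1 d2 ABC pB pC] u0 x au lx.
  by rewrite ge_min term.
rewrite ge_min; apply/orP; right.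
have w10 : w1 <> [::].
  apply: (parse_neq0 eps_isolated _ pB).
  by exists (binary_rule A B C) => //=; rewrite !inE eqxx.
have w20 : w2 <> [::].
  apply: (parse_neq0 eps_isolated _ pC).
  by exists (binary_rule A B C) => //=; rewrite !inE eqxx orbT.
have := hi_le x; have := hi_append au; rewrite size_cat => hx hxn.
have [|x1 au1] := @append_exists _ _ a w1; first by lia.
have x1u2 := append_cat au1 au; set g := lsp L x1.
have hg : hi g = (hi a + size w1)%N by rewrite hi_lsp (hi_append au1).
have [|y gu2] := @append_exists _ _ g w2; first by lia.
have ly : lsp L y = b by rewrite (lsp_append x1u2 gu2).
have hb : hi b = hi x by rewrite -lx hi_lsp.
have ga : follows L g a by apply: follows_lsp au1.
have bg : follows L b g by rewrite -ly; apply: follows_lsp gu2 => //; apply: lsp_Pi.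
have s1 : (0 < size w1)%N by rewrite lt0n size_eq0; apply/eqP.
have s2 : (0 < size w2)%N by rewrite lt0n size_eq0; apply/eqP.
apply: (@bigmin_inf _ _ _ _ (B, C)) => //.
apply: (@bigmin_inf _ _ _ _ g); first by rewrite lsp_Pi bg ga.
have leB : M B a g <= (f x1 + d1)%:E.
  by apply: (optM (a, g) ga _ _ _ _ _ w10) => //=; lia.
have leC : M C g b <= (f y + d2)%:E.
  by apply: (optM (g, b) bg _ _ _ _ _ w20) => //=; lia.
apply: (@le_trans _ _ ((f x1 + d1)%:E + (f y + d2)%:E - (f g)%:E
  + (weight G (binary_rule A B C))%:E)).
  by rewrite !leeD2r // leeD.
(* Since [f x = f x1 + f y - f g], the two sides are in fact equal. *)
rewrite -!(EFinN, EFinD) lee_fin (pattern_cost_lsp_append c x1u2 gu2).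
by rewrite -/g le_eqVlt; apply/orP; left; apply/eqP; ring.
Qed.

Lemma optimal_le M M' a b :
  (forall A, M' A a b <= M A a b) -> optimal M a b -> optimal M' a b.
Proof.
move=> le_M opt A u d x u0 p au lx.
by apply: (le_trans (le_M A)); apply: opt au lx.
Qed.

Lemma step3_optimal M order3 a b :
  (forall a b A w x, a \in Pi n L -> terminal_rule A w \in rules G ->
     w <> [::] -> append a w = Some x -> lsp L x = b ->
     M A a b <= (f x + weight G (terminal_rule A w))%:E) ->
  (forall p, p \in order3 <-> step3_index L p) ->
  sorted (@increasing_gap D n) order3 ->
  follows L b a -> optimal (step3 L c G order3 M) a b.
Proof.
move=> term enum3 sorted3 ba.
(* Induction on the part [s1] already processed: all its pairs are optimal and stay so. *)
suff opt s1 s2 : order3 = s1 ++ s2 ->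
    forall p, p \in s1 -> optimal (step3 L c G s1 M) p.1 p.2.
  by apply: (opt order3 [::] _ (a, b)); [rewrite cats0 | apply/enum3].
elim/last_ind: s1 s2 => [//|s p IH] s2 eq3 q.
have {}IH := IH (p :: s2) _; rewrite -cat_rcons in IH; have {}IH := IH eq3.
rewrite /step3 -cats1 foldl_cat /= mem_cat inE => /orP[qs|/eqP->{q}].
  apply: optimal_le (IH q qs) => A; exact: step3_update_le.
have pin : p \in order3 by rewrite eq3 mem_cat mem_rcons inE eqxx.
have {pin} pidx : step3_index L p by apply/enum3.
case: p => a' b' /= in IH eq3 pidx *.
have a'Pi : a' \in Pi n L by case/and5P: pidx.
apply: step3_update_optimal => //.
  move=> A w x Aw w0 aw lx; apply: le_trans (step3_le _ _ _ _ _) _.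
  exact: term aw lx.
move=> q qfol lt_gap; apply: IH.
(* By sortedness, a pair of strictly smaller gap cannot come after [p], so it was processed
   before. *)
have : q \in order3 by apply/enum3.
rewrite eq3 cat_rcons mem_cat inE => /or3P[//|/eqP eqq|qs2].
  by rewrite eqq ltnn in lt_gap.
move: sorted3; rewrite eq3 cat_rcons sorted_pairwise; last first.
  by move=> ? ? ?; apply: leq_trans.
rewrite pairwise_cat /= => /and4P[_ _ /allP/(_ q qs2)].
by rewrite /increasing_gap /= leqNgt lt_gap.
Qed.

End Messages.

(** * The returned value *)

Theorem theorem2 (R : realType) (D N : finType) (n : nat)
  (L : {fset seq D}) (c : pattern n D -> R) (G : grammar R D N)
  (order2 : seq (N * seq D * pattern n D))
  (order3 : seq (pattern n D * pattern n D)) :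
  (1 <= n)%N ->
  chomsky_normal_form G ->
  (forall A w, terminal_rule A w \in rules G ->
     w \in L \/ (A = start G /\ w = [::])) ->
  epsilon_rules_isolated G ->
  enumerates (step2_index L G) order2 ->
  enumerates (step3_index L) order3 ->
  sorted (@increasing_gap D n) order3 ->
  procedure L c G order2 order3 =
    \big[mine/+oo]_(x in patterns_on n D 1 n) total_cost L c G x.
Proof.
move=> n_gt0 cnf termL isol [_ enum2] [_ enum3] sorted3.
have sub2 : forall t, t \in order2 -> step2_index L G t.
  by move=> t /enum2.
rewrite /procedure /result; set M := step3 _ _ _ _ _.
have attM : attained L c G M by apply/step3_attained/step2_attained.
have optM a b : follows L b a -> optimal L c G M a b.
  apply: step3_optimal => // {}a {}b A w x aPi Aw w0 aw <-.
  by rewrite (step2_terminal c termL sub2 _ w0 aw) //; apply/enum2.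
apply/eqP; rewrite eq_le; apply/andP; split; apply: le_bigmin; rewrite ?leey //.
- move=> x; rewrite inE => /andP[/eqP[lox] /eqP hix].
  (* Moving the finite [f x] to the left isolates the infimum, which is then bounded one derivation
     at a time. *)
  rewrite /total_cost -leeBlDl //; apply: le_ereal_inf_tmp => _ [d /= der <-].
  have px := (derivationP cnf _ _ _).1 der.
  have eps_x : append (eps D ord0) (word x) = Some x by apply/appendP.
  (* [optM] needs a nonempty word; here [1 <= n] provides it. *)
  have x0 : word x <> [::].
    move=> x0; move: hix; rewrite hiE x0 addn0 /off lox; lia.
  rewrite EFinN leeBlDl // -EFinD.
  apply: (@bigmin_inf _ _ _ _ (lsp L x)).
    by rewrite inE lsp_Pi hi_lsp hix /=.
  apply: (optM _ _ _ _ _ _ _ x0 px eps_x) => //.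
  by apply: follows_lsp x0 eps_x; apply: Pi_eps.
- move=> a; rewrite inE => /andP[aPi /eqP hia].
  have [->|[u [d [x [eps_u pu lx ->]]]]] := attM (start G) (eps D ord0) a.
    exact: leey.
  (* [lsp] keeps the end, so the word behind a finite message fills all of [[1,n]] and is a
     candidate on the right. *)
  have hx : hi x = n by rewrite -(hi_lsp L) lx.
  case/appendP: eps_u => eqo eqw.
  apply: (@bigmin_inf _ _ _ _ x).
    by rewrite inE hx eqxx andbT loE eqo.
  rewrite /total_cost EFinD leeD2l //; apply: ereal_inf_lbound.
  by exists d => //=; apply/(derivationP cnf); rewrite eqw.
Qed.
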